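(* Let $G=G_1\oplus G_2$ be a finitely generated abelian group with $G_1\cong\mathbb{Z}^m$ and $G_2\cong\bigoplus_{i=1}^l\mathbb{Z}_{q_i}$, let $S$ be a finite symmetric generating set of $G$, let $n\ge 1$ be an integer and let $d\ge 0$ be real. Then $$H^{n,d}(G,S)=H^{n,d}(G_1,\pi_{G_1}S),$$ where a function $g$ on $G_1$ is identified with the function $g\circ\pi_{G_1}$ on $G$. Moreover, any $f\in H^{n,d}(G,S)$ is a polynomial on $G_1\cong\mathbb{Z}^m$ and constant on $G_2$ (i.e. $f(x+w)=f(x)$ for all $x\in G$, $w\in G_2$). In addition, $$\dim H^{n,d}(G,S)=\sum_{i=[d]-2n+1}^{[d]}\binom{m+i-1}{i},$$ where $[d]$ is the largest integer not exceeding $d$ and $\binom{m+i-1}{i}=0$ for $i<0$.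
   Context: Group: $m\ge 1$ and $l\ge 0$ are integers ($l=0$ being the torsion-free case), and each $q_i=p_i^{a_i}$ is a prime power. $\pi_{G_1}:G\to G_1$ is the projection $x_1+x_2\mapsto x_1$ ($x_1\in G_1$, $x_2\in G_2$). Generating sets: a finite symmetric generating set is a finite list $S=(s_1,\dots,s_{2r})$ of elements generating $G$ with $s_{i+r}=-s_i$ for $1\le i\le r$; repetitions are allowed and $0\in S$ is allowed. $\pi_{G_1}S=(\pi_{G_1}s_1,\dots,\pi_{G_1}s_{2r})$, taken as a list (keeping repetitions and zeros), is a finite symmetric generating set of $G_1$. The Cayley graph $(G,S)$ has vertex set $G$ and $x\sim y$ iff $y-x\in S$; sums over $y\sim x$ are taken with multiplicity, i.e. $\sum_{y\sim x}h(y)=\sum_{i=1}^{2r}h(x+s_i)$. $d^S$ is the word metric (length of a shortest path in the Cayley graph). Operators: $L^Su(x)=\sum_{y\sim x}(u(y)-u(x))$, and $L^{n,S}=L^S\circ\cdots\circ L^S$ ($n$-fold composition). Function spaces: for a fixed base point $p\in G$, $$H^{n,d}(G,S)=\{u:G\to\mathbb{R}\mid L^{n,S}u=0 \text{ on } G,\ \exists C:\ |u(x)|\le C(d^S(p,x)+1)^d\ \forall x\in G\};$$ $H^{n,d}(G_1,\pi_{G_1}S)$ is defined in the same way for the group $G_1$ with generating set $\pi_{G_1}S$. A function on $\mathbb{Z}^m$ is called a polynomial if it is the restriction to $\mathbb{Z}^m$ of a real polynomial on $\mathbb{R}^m$. *)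

(* Defs.v *)
From HB Require Import structures.
From mathcomp Require Import all_boot all_order all_algebra.
From mathcomp Require Import all_classical all_reals all_analysis.
(* Not imported: the notations of mpoly clash with those of MathComp-Analysis. *)
From mathcomp Require mpoly.

Set Implicit Arguments.
Unset Strict Implicit.
Unset Printing Implicit Defensive.

Import Order.TTheory GRing.Theory Num.Theory.
Local Open Scope classical_set_scope.
Local Open Scope ring_scope.

Definition generates (G : zmodType) (S : seq G) : Prop :=
  forall H : {pred G}, zmod_closed H -> {subset S <= H} -> forall x, x \in H.

(* The list is 0-indexed: S = [:: s_0; ...; s_(2r-1)] with s_(i+r) = - s_i for
   i < r. *)
Definition symmetric_generating (G : zmodType) (S : seq G) : Prop :=
  generates S /\
  exists r : nat, size S = r.*2 /\
    forall i : nat, (i < r)%N -> S`_(i + r) = - S`_i.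

Definition adjacent (G : zmodType) (S : seq G) : rel G :=
  fun x y => y - x \in S.

Definition has_walk (G : zmodType) (S : seq G) (x y : G) (k : nat) : Prop :=
  exists w : seq G, [/\ path (adjacent S) x w, last x w = y & size w = k].

(* The default value 0 is only taken when y is not reachable from x, which does
   not happen when S is a symmetric generating list. *)
Definition word_dist (G : zmodType) (S : seq G) (x y : G) : nat :=
  xget 0%N [set k | has_walk S x y k /\
                    forall j, has_walk S x y j -> (k <= j)%N].

Section FunctionSpaces.
Variables (R : realType) (G : zmodType).

(* Summing over the list S counts neighbours with multiplicity. *)
Definition laplacian (S : seq G) (u : G -> R) : G -> R :=
  fun x => \sum_(s <- S) (u (x + s) - u x).

Definition iter_laplacian (n : nat) (S : seq G) (u : G -> R) : G -> R :=
  iter n (laplacian S) u.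

Definition polyharmonic_space (n : nat) (d : R) (S : seq G) (p : G) :
    set (G -> R) :=
  [set u | (forall x, iter_laplacian n S u x = 0) /\
           exists C : R, forall x,
             `|u x| <= C * ((word_dist S p x)%:R + 1) `^ d].

End FunctionSpaces.

Definition is_polynomial_function (R : realType) (m : nat)
    (g : 'rV[int]_m -> R) : Prop :=
  exists P : mpoly.mpoly m R,
    forall z : 'rV[int]_m, g z = mpoly.meval (fun i => (z 0 i)%:~R) P.

(* H has a basis of N vectors; in particular H is a linear subspace of V. *)
Definition has_dim (K : fieldType) (V : lmodType K) (H : set V) (N : nat) :
    Prop :=
  exists e : 'I_N -> V,
    (forall c : 'I_N -> K, \sum_i c i *: e i = 0 -> forall i, c i = 0) /\
    H = [set u | exists c : 'I_N -> K, u = \sum_i c i *: e i].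

(* binom(m + i - 1, i), equal to 0 for i < 0; the truncated predecessor is the
   true one as soon as 1 <= m. *)
Definition multichoose (m : nat) (i : int) : nat :=
  match i with
  | Posz k => 'C((m + k).-1, k)
  | Negz _ => 0%N
  end.

(* Main.v *)
Require Import Defs.
From HB Require Import structures.
From mathcomp Require Import all_boot all_order all_algebra.
From mathcomp Require Import all_classical all_reals all_analysis.
From mathcomp Require Import ring lra zify.
From mathcomp Require Import (canonicals) mpoly.

Set Implicit Arguments.
Unset Strict Implicit.
Unset Printing Implicit Defensive.

Import Order.TTheory GRing.Theory Num.Theory.
Local Open Scope classical_set_scope.
Local Open Scope ring_scope.

(** Write [D_s u x = u (x + s) - u x].

    Liouville. If [u] is harmonic then [L (u ^ 2) = sum_s (D_s u) ^ 2], and each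
    [D_s u] is again harmonic, so [L^k (u ^ 2)] is the sum of the squares of all
    [k]-fold differences of [u] along [S]; in particular it is nonnegative for
    every [k]. The [t]-step random walk mean of [u ^ 2] is
    [sum_j C(t, j) |S|^-j L^j (u ^ 2)], hence at least [C(t, k) |S|^-k L^k (u ^ 2)],
    whereas polynomial growth bounds it by [O(t ^ (2 d))]. So [L^k (u ^ 2) = 0],
    and the [k]-fold differences of [u] vanish, once [k > 2 d]. The polyharmonic
    case follows by induction on [n], and [H^(n,d)] turns out to be the space of
    solutions of [L^n u = 0] whose [([d] + 1)]-fold differences vanish. Such
    functions are invariant under torsion, since a polynomial which is periodic
    is constant.

    Dimension. [L] lowers the degree by [2] because [S] is symmetric. In the Newton
    basis of [Z^m], [L^n] is surjective from degree [<= k] onto degree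
    [<= k - 2 n]: for reasons of dimension it suffices that it is injective on
    the span of the Newton polynomials of order [>= 2 n] in one fixed coordinate.
    By induction on the degree this reduces to polynomials in that coordinate
    alone, on which [2 L] acts to leading order as a positive multiple of the
    second difference. *)

(** * Iterated differences and degree *)

Section Differences.
Variables (R : realType) (G : zmodType).
Implicit Types (u v : G -> R) (s t x : G) (S : seq G) (k n : nat).

Definition fdiff s u : G -> R := fun x => u (x + s) - u x.

(* [degree_lt k u]: every [k]-fold iterated difference of [u] vanishes. On
   [Z^m] this says that [u] is a polynomial of degree [< k]. *)
Fixpoint degree_lt k u : Prop :=
  if k is k'.+1 then forall s, degree_lt k' (fdiff s u) else forall x, u x = 0.

Lemma fdiffC s t u : fdiff s (fdiff t u) = fdiff t (fdiff s u).
Proof. by apply/funext => x; rewrite /fdiff (addrAC x s t); ring. Qed.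

Lemma fdiff_lin s (a b : R) t u v :
  fdiff s (fun x => a * u x + b * v (x + t)) =
  fun x => a * fdiff s u x + b * fdiff s v (x + t).
Proof. by apply/funext => x; rewrite /fdiff (addrAC x s t); ring. Qed.

Lemma fdiff_sum (I : Type) (r : seq I) (F : I -> G -> R) s :
  fdiff s (fun x => \sum_(i <- r) F i x) = fun x => \sum_(i <- r) fdiff s (F i) x.
Proof. by apply/funext => x; rewrite /fdiff -sumrB. Qed.

Lemma fdiff_laplacian s S u : fdiff s (laplacian S u) = laplacian S (fdiff s u).
Proof.
rewrite (fdiff_sum S (fun t => fdiff t u)); apply/funext => x.
by apply: eq_bigr => t _; rewrite fdiffC.
Qed.

Lemma fdiff_iter_laplacian n s S u :
  fdiff s (iter_laplacian n S u) = iter_laplacian n S (fdiff s u).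
Proof. by elim: n => //= n IH; rewrite fdiff_laplacian IH. Qed.

Lemma iter_laplacianSr n S u :
  iter_laplacian n.+1 S u = iter_laplacian n S (laplacian S u).
Proof. exact: iterSr. Qed.

Lemma degree_lt0 k : degree_lt k (fun=> 0 : R).
Proof.
elim: k => //= k IH s; rewrite (_ : fdiff s _ = fun=> 0) //.
by apply/funext => x; rewrite /fdiff subrr.
Qed.

Lemma degree_lt_lin k (a b : R) t u v : degree_lt k u -> degree_lt k v ->
  degree_lt k (fun x => a * u x + b * v (x + t)).
Proof.
elim: k u v => [|k IH] u v /= hu hv; first by move=> x; rewrite hu hv !mulr0 addr0.
by move=> s; rewrite fdiff_lin; apply: IH.
Qed.

Lemma degree_ltD k u v : degree_lt k u -> degree_lt k v ->
  degree_lt k (fun x => u x + v x).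
Proof.
move=> hu hv; rewrite (_ : (fun x => _) = fun x => 1 * u x + 1 * v (x + 0)).
  exact: degree_lt_lin.
by apply/funext => x; rewrite !mul1r addr0.
Qed.

Lemma degree_ltZ k (a : R) u : degree_lt k u -> degree_lt k (fun x => a * u x).
Proof.
move=> hu; rewrite (_ : (fun x => _) = fun x => a * u x + 0 * u (x + 0)).
  exact: degree_lt_lin.
by apply/funext => x; rewrite mul0r addr0.
Qed.

Lemma degree_lt_sum k (I : eqType) (r : seq I) (F : I -> G -> R) :
  (forall i, i \in r -> degree_lt k (F i)) ->
  degree_lt k (fun x => \sum_(i <- r) F i x).
Proof.
elim: r => [|i r IH] hF.
  by rewrite (_ : (fun x => _) = fun=> 0) ?funeqE => [|x]; rewrite ?big_nil //;
    exact: degree_lt0.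
rewrite (_ : (fun x => _) = fun x => F i x + \sum_(j <- r) F j x); last first.
  by apply/funext => x; rewrite big_cons.
by apply: degree_ltD; [apply: hF; rewrite inE eqxx |
  apply: IH => j hj; apply: hF; rewrite inE hj orbT].
Qed.

Lemma degree_ltW k u : degree_lt k u -> degree_lt k.+1 u.
Proof.
elim: k u => [|k IH] u /= hu s; last by apply: IH.
by move=> x; rewrite /fdiff !hu subrr.
Qed.

Lemma degree_lt_leq k j u : (k <= j)%N -> degree_lt k u -> degree_lt j u.
Proof.
by move=> /subnK <- hu; elim: (j - k)%N => //= i IH; apply: (@degree_ltW _ u).
Qed.

(** The [s] with [P (fdiff s u)] form a subgroup: [fdiff (t - r) u] is the translate by [- r] of
    [fdiff t u - fdiff r u]. *)
Lemma fdiff_generated S (P : (G -> R) -> Prop) u : generates S ->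
  P (fun=> 0) ->
  (forall v w t, P v -> P w -> P (fun x => v (x + t) - w (x + t))) ->
  (forall s, s \in S -> P (fdiff s u)) -> forall s, P (fdiff s u).
Proof.
move=> gS P0 PB PS s.
have := gS [pred s | `[< P (fdiff s u) >]].
suff h : zmod_closed [pred s | `[< P (fdiff s u) >]].
  by move=> /(_ h) H; apply/asboolP; apply: (H _ s) => t /PS Pt; apply/asboolP.
split=> [|t r /asboolP Pt /asboolP Pr]; apply/asboolP.
  by rewrite (_ : fdiff 0 u = fun=> 0) // funeqE => x; rewrite /fdiff addr0 subrr.
rewrite (_ : fdiff _ u = fun x => fdiff t u (x + - r) - fdiff r u (x + - r)).
  exact: PB.
by apply/funext => x; rewrite /fdiff subrK (addrA x t) (addrAC x); ring.
Qed.

Lemma degree_lt_generators S k u : generates S ->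
  (forall s, s \in S -> degree_lt k (fdiff s u)) -> degree_lt k.+1 u.
Proof.
move=> gS; apply: fdiff_generated gS _ _ => [|v w t hv hw]; first exact: degree_lt0.
rewrite (_ : (fun x => _) = (fun y => 1 * v y + (-1) * w (y + 0)) \o +%R^~ t);
  last by apply/funext => x /=; rewrite addr0; ring.
have := degree_lt_lin 1 (-1) 0 hv hw; set h := fun x => _.
move=> /(degree_lt_lin 0 1 t hv); congr degree_lt.
by apply/funext => x; rewrite mul0r mul1r add0r.
Qed.

Lemma fdiff_eq0_generators S u : generates S ->
  (forall s, s \in S -> forall x, fdiff s u x = 0) -> forall x y, u x = u y.
Proof.
move=> gS h x y; have /= := degree_lt_generators (k := 0) gS h.
by move=> /(_ (x - y) y) /eqP; rewrite /fdiff (addrC y) subrK subr_eq0 => /eqP.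
Qed.

(** By induction on the degree, the differences of [u] are invariant under [w], so [fdiff w u] is a
    constant [c]. Then [u (x + w *+ j) = u x + j * c], and [j = q] forces [c = 0]. *)
Lemma degree_lt_torsion k u w (q : nat) : (0 < q)%N -> w *+ q = 0 ->
  degree_lt k u -> forall x, u (x + w) = u x.
Proof.
move=> q0 qw hk x; apply/eqP; rewrite -subr_eq0; apply/eqP.
move: x; change (forall x, fdiff w u x = 0).
elim: k u hk => [|k IH] u /= hu x; first by rewrite /fdiff !hu subrr.
have cst y : fdiff w u y = fdiff w u x.
  have := IH _ (hu (y - x)) x; rewrite fdiffC /fdiff.
  by rewrite -[x + (y - x)]addrC subrK => /eqP; rewrite subr_eq0 => /eqP.
have lin j : u (x + w *+ j) = u x + j%:R * fdiff w u x.
  elim: j => [|j IHj]; first by rewrite mulr0n addr0 mul0r addr0.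
  rewrite mulrSr addrA -[LHS](subrK (u (x + w *+ j))) -/(fdiff w u _) cst IHj.
  by rewrite -natr1; ring.
have := lin q; rewrite qw addr0 => /eqP.
rewrite -subr_eq0 opprD addrA subrr sub0r oppr_eq0 mulf_eq0 pnatr_eq0.
by rewrite -leqn0 leqNgt q0 /= => /eqP.
Qed.

End Differences.

(** * Pull-back along additive maps *)

Lemma fdiff_comp (R : realType) (G H : zmodType) (pi : {additive G -> H})
    (f : H -> R) s : fdiff s (f \o pi) = fdiff (pi s) f \o pi.
Proof. by apply/funext => x; rewrite /fdiff /= raddfD. Qed.

Lemma degree_lt_comp (R : realType) (G H : zmodType) (pi : {additive G -> H})
    (f : H -> R) k : (forall y, exists x, pi x = y) ->
  degree_lt k (f \o pi) <-> degree_lt k f.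
Proof.
move=> surj; elim: k f => [|k IH] f /=.
  by split=> h x; last exact: h; have [y <-] := surj x; exact: h.
split=> h s; last by rewrite fdiff_comp; apply/IH.
by have [y <-] := surj s; apply/IH; rewrite -fdiff_comp.
Qed.

Lemma laplacian_comp (R : realType) (G H : zmodType) (pi : {additive G -> H})
    (S : seq G) (f : H -> R) :
  laplacian S (f \o pi) = laplacian (map pi S) f \o pi.
Proof.
apply/funext => x; rewrite /laplacian /= big_map.
by apply: eq_bigr => s _ /=; rewrite raddfD.
Qed.

Lemma iter_laplacian_comp (R : realType) (G H : zmodType)
    (pi : {additive G -> H}) (S : seq G) (f : H -> R) n :
  iter_laplacian n S (f \o pi) = iter_laplacian n (map pi S) f \o pi.
Proof. by elim: n => //= n IH; rewrite IH laplacian_comp. Qed.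

Lemma symmetric_generating_map (G H : zmodType) (pi : {additive G -> H})
    (S : seq G) : (forall y, exists x, pi x = y) ->
  symmetric_generating S -> symmetric_generating (map pi S).
Proof.
move=> surj [gS [r [szS symS]]]; split.
  move=> K [K0 KB] KS y; have [x <-] := surj y.
  apply: (gS [pred x | pi x \in K]).
    by split=> [|a b]; rewrite !inE ?raddf0 ?raddfB //; apply: KB.
  by move=> s sS; rewrite inE; apply: KS; apply: map_f.
exists r; rewrite size_map; split=> // i ir.
have ltS : (i + r < size S)%N by rewrite szS -addnn ltn_add2r.
rewrite !(nth_map 0) ?symS ?raddfN //.
by apply: leq_ltn_trans ltS; rewrite leq_addr.
Qed.

(** * Symmetric generating sets *)

Section Symmetric.
Variables (R : realType) (G : zmodType) (S : seq G).
Hypothesis symS : symmetric_generating S.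

Lemma symmetric_perm : perm_eq (map -%R S) S.
Proof.
case: symS => _ [r [szS hS]].
(* The second half of the list is the negated first half, so negation exchanges the two. *)
have -> : S = take r S ++ map -%R (take r S).
  rewrite -[LHS](cat_take_drop r); congr cat.
  have szt : size (take r S) = r.
    by rewrite size_takel // szS -addnn leq_addr.
  apply: (@eq_from_nth _ 0).
    by rewrite size_map szt size_drop szS -addnn addnK.
  move=> i; rewrite size_drop szS -addnn addnK => ir.
  by rewrite nth_drop addnC hS // (nth_map 0) ?szt // nth_take.
by rewrite map_cat (mapK (@opprK G)) perm_catC.
Qed.

Lemma oppr_symmetric s : s \in S -> - s \in S.
Proof. by move=> sS; rewrite -(perm_mem symmetric_perm) map_f. Qed.

(* Averaging over [s] and [-s]: [fdiff s u + fdiff (-s) u = - fdiff s (fdiff (-s) u)]. *)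
Lemma laplacian_diff2 (u : G -> R) x :
  laplacian S u x *+ 2 = - \sum_(s <- S) fdiff s (fdiff (- s) u) x.
Proof.
rewrite mulr2n /laplacian -[X in X + _](perm_big _ symmetric_perm) /= big_map.
rewrite -big_split /= -sumrN; apply: eq_bigr => s _.
by rewrite /fdiff addrK; ring.
Qed.

(** By [laplacian_diff2], [L] is [- 1/2] times a sum of second differences. *)
Lemma degree_lt_laplacian k (u : G -> R) :
  degree_lt k.+2 u -> degree_lt k (laplacian S u).
Proof.
move=> hu; rewrite (_ : laplacian S u =
  fun x => (- 2^-1) * \sum_(s <- S) fdiff s (fdiff (- s) u) x).
  by apply/degree_ltZ/degree_lt_sum => s _; exact: hu.
apply/funext => x; have := laplacian_diff2 u x; rewrite mulr2n.
by move: (laplacian S u x) => A; lra.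
Qed.

Lemma degree_lt_iter_laplacian n k (u : G -> R) :
  degree_lt (k + 2 * n) u -> degree_lt k (iter_laplacian n S u).
Proof.
elim: n u => [|n IH] u; first by rewrite muln0 addn0.
rewrite iter_laplacianSr => hu; apply: IH; apply: degree_lt_laplacian.
by move: hu; rewrite mulnS [(2 + _)%N]addnC addnA addn2.
Qed.

End Symmetric.

(** * Word metric and growth *)

Section WordMetric.
Variables (G : zmodType) (S : seq G).
Implicit Types (x y z s b : G) (w : seq G).

Lemma has_walkP x y k : has_walk S x y k <->
  exists w, [/\ {subset w <= S}, size w = k & y = x + \sum_(s <- w) s].
Proof.
split=> [[w [hp <- <-]]|[w [hw <- ->]]].
  elim: w x hp => [|z w IH] x /=; first by exists [::]; rewrite big_nil addr0.
  case/andP=> xz /IH [t [tS szt ->]]; exists (z - x :: t); split=> /=.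
  - by move=> s; rewrite inE => /predU1P[-> //|]; exact: tS.
  - by rewrite szt.
  - by rewrite big_cons addrA (addrC x) subrK.
elim: w x hw => [|s w IH] x hw; first by exists [::]; rewrite big_nil addr0.
have [|t [pt lt szt]] := IH (x + s).
  by move=> r rw; apply: hw; rewrite inE rw orbT.
exists (x + s :: t); split=> /=; last by rewrite szt.
  by rewrite pt andbT /Defs.adjacent addrAC subrr add0r hw // inE eqxx.
by rewrite lt big_cons addrA.
Qed.

Hypothesis symS : symmetric_generating S.

(** Sums of words in [S] form a subgroup, because [S] is closed under negation. *)
Lemma walk_exists x : exists2 w, {subset w <= S} & x = \sum_(s <- w) s.
Proof.
case: (symS) => gS _.
have := gS [pred y | `[< exists2 w, {subset w <= S} & y = \sum_(s <- w) s >]].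
set P := pred_of_simpl _.
have PP y : reflect (exists2 w, {subset w <= S} & y = \sum_(s <- w) s) (y \in P).
  exact: asboolP.
move=> /(_ _ _ x) H; apply/PP; apply: H; last first.
  move=> s sS; apply/PP; exists [:: s]; last by rewrite big_seq1.
  by move=> t; rewrite inE => /eqP->.
split=> [|y z /PP[w wS ->] /PP[t tS ->]]; apply/PP.
  by exists [::] => //; rewrite big_nil.
exists (w ++ map -%R t); last by rewrite big_cat big_map sumrN.
move=> s; rewrite mem_cat => /orP[/wS//|/mapP[r /tS rS ->]].
exact: oppr_symmetric.
Qed.

Lemma word_dist_prop x y : has_walk S x y (word_dist S x y) /\
  forall j, has_walk S x y j -> (word_dist S x y <= j)%N.
Proof.
apply: (@xgetPex nat 0%N [set k | has_walk S x y k /\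
                    forall j, has_walk S x y j -> (k <= j)%N]).
have ex : exists k, `[< has_walk S x y k >].
  have [w wS e] := walk_exists (y - x).
  exists (size w); apply/asboolP/has_walkP; exists w; split=> //.
  by rewrite -e addrC subrK.
exists (ex_minn ex); case: ex_minnP => k /asboolP hk min; split=> // j hj.
by apply: min; apply/asboolP.
Qed.

Lemma word_dist_walk x y : exists w,
  [/\ {subset w <= S}, size w = word_dist S x y & y = x + \sum_(s <- w) s].
Proof. by apply/has_walkP; have [] := word_dist_prop x y. Qed.

Lemma word_dist_leq x w : {subset w <= S} ->
  (word_dist S x (x + \sum_(s <- w) s) <= size w)%N.
Proof.
by move=> wS; have [_ -> //] := word_dist_prop x (x + \sum_(s <- w) s);
  apply/has_walkP; exists w.
Qed.

Lemma word_distD b x y :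
  (word_dist S b (x + y) <= word_dist S b x + word_dist S 0 y)%N.
Proof.
have [w [wS <- ->]] := word_dist_walk b x.
have [t [tS <- ->]] := word_dist_walk 0 y.
rewrite add0r -addrA -big_cat -size_cat; apply: word_dist_leq => s.
by rewrite mem_cat => /orP[/wS|/tS].
Qed.

Lemma word_dist_step b x s :
  s \in S -> (word_dist S b (x + s) <= (word_dist S b x).+1)%N.
Proof.
move=> sS; apply: leq_trans (word_distD b x s) _; rewrite -addn1 leq_add2l.
have := @word_dist_leq 0 [:: s]; rewrite big_seq1 add0r; apply.
by move=> t; rewrite inE => /eqP->.
Qed.

Lemma word_dist_mulrn s t : (word_dist S 0 (s *+ t) <= t * word_dist S 0 s)%N.
Proof.
elim: t => [|t IH].
  by have := @word_dist_leq 0 [::]; rewrite mulr0n big_nil addr0; apply.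
rewrite mulrSr mulSn addnC; apply: leq_trans (word_distD _ _ _) _.
by rewrite leq_add2r.
Qed.

Lemma word_dist_self b : word_dist S b b = 0%N.
Proof.
apply/eqP; rewrite -leqn0; have := @word_dist_leq b [::].
by rewrite big_nil addr0; apply.
Qed.

End WordMetric.

Section Growth.
Variables (R : realType) (G : zmodType) (S : seq G) (b : G).
Hypothesis symS : symmetric_generating S.
Implicit Types (u v : G -> R) (d : R).

Let N x : nat := word_dist S b x.

Definition growth d u := exists C : R, forall x,
  `|u x| <= C * ((word_dist S b x)%:R + 1) `^ d.

(** At the base point the weight is [1], so [C] dominates [|u b|]. *)
Lemma growth_pos d u : growth d u ->
  exists2 C : R, 0 <= C & forall x, `|u x| <= C * ((N x)%:R + 1) `^ d.
Proof.
case=> C hC; exists C => //; have := hC b.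
rewrite /N word_dist_self // add0r powR1 mulr1; exact: le_trans.
Qed.

Lemma growth_lin d (a c : R) t u v : 0 <= d -> growth d u -> growth d v ->
  growth d (fun x => a * u x + c * v (x + t)).
Proof.
move=> d0 /growth_pos[C C0 hC] /growth_pos[D D0 hD].
pose K : R := (word_dist S 0 t)%:R + 1.
exists (`|a| * C + `|c| * (D * K `^ d)) => x.
apply: le_trans (ler_normD _ _) _; rewrite !normrM mulrDl -!mulrA.
apply: lerD; first by rewrite ler_wpM2l ?hC.
rewrite ler_wpM2l //; apply: le_trans (hD _) _.
rewrite ler_wpM2l // -powRM ?addr_ge0 // ge0_ler_powR ?nnegrE ?mulr_ge0 ?addr_ge0 //.
(* The triangle inequality gives [N (x + t) + 1 <= K * (N x + 1)]. *)
have := word_distD symS b x t; rewrite -/(N _) -/(N x) -(ler_nat R) natrD => h.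
have : 0 <= (N x)%:R * (word_dist S 0 t)%:R :> R by apply: mulr_ge0.
by rewrite /K; nra.
Qed.

Lemma growth_fdiff d s u : 0 <= d -> growth d u -> growth d (fdiff s u).
Proof.
move=> d0 hu; rewrite (_ : fdiff s u = fun x => (-1) * u x + 1 * u (x + s)).
  exact: growth_lin.
by apply/funext => x; rewrite /fdiff; ring.
Qed.

Lemma growth0 d : growth d (fun=> 0 : R).
Proof. by exists 0 => x; rewrite mul0r normr0. Qed.

Lemma growth_laplacian d u : 0 <= d -> growth d u -> growth d (laplacian S u).
Proof.
move=> d0 hu; rewrite /laplacian; elim: {1}S => [|s r IH].
  by rewrite (_ : (fun x => _) = fun=> 0) ?funeqE => [|x]; rewrite ?big_nil //;
    exact: growth0.
rewrite (_ : (fun x => _) = fun x =>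
    1 * fdiff s u x + 1 * (\sum_(t <- r) (u (x + 0 + t) - u (x + 0)))).
  exact: (growth_lin 1 1 0 d0 (growth_fdiff s d0 hu) IH).
by apply/funext => x; rewrite big_cons !mul1r addr0.
Qed.

Lemma growth_iter_laplacian d n u : 0 <= d -> growth d u ->
  growth d (iter_laplacian n S u).
Proof. by move=> d0 hu; elim: n => //= n IH; apply: growth_laplacian. Qed.

(** Along a shortest walk from [b] to [x] the increments of [u] are first differences, bounded by
    induction; there are [N x] of them, which costs one power of [N x + 1]. *)
Lemma degree_lt_growth k u : degree_lt k.+1 u -> growth k%:R u.
Proof.
move=> hu; suff [C C0 hC] : exists2 C : R, 0 <= C &
    forall x, `|u x| <= C * ((N x)%:R + 1) ^+ k.
  by exists C => x; rewrite powR_mulrn ?addr_ge0.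
elim: k u hu => [|k IH] u hu.
  exists `|u b| => // x; rewrite expr0 mulr1.
  have /eqP := hu (x - b) b; rewrite /fdiff (addrC b) subrK subr_eq0.
  by move=> /eqP->.
have [C C0 hC] : exists2 C : R, 0 <= C &
    forall s, s \in S -> forall x, `|fdiff s u x| <= C * ((N x)%:R + 1) ^+ k.
  elim: {1}S => [|s r [C C0 hC]]; first by exists 0.
  have [D D0 hD] := IH _ (hu s).
  exists (C + D) => [|t]; first exact: addr_ge0.
  have p x : 0 <= ((N x)%:R + 1 : R) ^+ k by rewrite exprn_ge0 ?addr_ge0.
  rewrite inE => /predU1P[->|/hC h] x; rewrite mulrDl.
    by apply: le_trans (hD x) _; rewrite lerDr mulr_ge0.
  by apply: le_trans (h x) _; rewrite lerDl mulr_ge0.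
have walk w : {subset w <= S} -> `|u (b + \sum_(s <- w) s)| <=
    `|u b| + (size w)%:R * (C * ((size w)%:R + 1) ^+ k).
  elim/last_ind: w => [|w s IHw] wS.
    by rewrite big_nil addr0 mul0r addr0.
  have wS' : {subset w <= S} by move=> t tw; apply: wS; rewrite mem_rcons inE tw orbT.
  have sS : s \in S by apply: wS; rewrite mem_rcons inE eqxx.
  rewrite -cats1 big_cat big_seq1 addrA size_cat addn1 /=.
  set y := b + _; rewrite -[u (y + s)](subrK (u y)) -/(fdiff s u y).
  have h1 := ler_normD (fdiff s u y) (u y).
  have h2 := IHw wS'; rewrite -/y in h2; have h3 := hC _ sS y.
  have mono : ((N y)%:R + 1 : R) ^+ k <= ((size w)%:R + 1) ^+ k.
    rewrite lerXn2r ?nnegrE ?addr_ge0 // lerD2r ler_nat.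
    exact: (word_dist_leq symS).
  have mono' : ((size w)%:R + 1 : R) ^+ k <= ((size w).+1%:R + 1) ^+ k.
    by rewrite lerXn2r ?nnegrE ?addr_ge0 // lerD2r ler_nat.
  have m1 := ler_wpM2l C0 mono; have m2 := ler_wpM2l C0 mono'.
  have m3 := ler_wpM2l (ler0n R (size w)) m2.
  by rewrite [in X in _ + X * _]mulrS mulrDl mul1r; lra.
exists (`|u b| + C) => [|x]; first exact: addr_ge0.
have [w [wS szw xE]] := word_dist_walk symS b x.
have := walk w wS; rewrite -xE szw => /le_trans; apply; rewrite /N; set m : R := _%:R.
have m0 : 0 <= m by apply: ler0n.
have q1 : 1 <= (m + 1) ^+ k by rewrite exprn_ege1 // lerDr.
rewrite exprS mulrDl; apply: lerD.
  by rewrite -[leLHS]mulr1 ler_wpM2l // -[leLHS]mulr1 ler_pM // lerDr.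
have q2 : 0 <= C * (m + 1) ^+ k by rewrite mulr_ge0 // ltW // (lt_le_trans ltr01).
by nra.
Qed.

End Growth.

(** * Liouville theorem *)

(** The falling factorial is the product of [t + 1], ..., [t + k]. *)
Lemma expn_leq_ffact k t : (t.+1 ^ k <= (k + t) ^_ k)%N.
Proof.
elim: k => [|k IH]; first by rewrite ffactn0 expn0.
by rewrite addSn ffactSS expnS leq_mul // ltnS leq_addl.
Qed.

(** Were [A] positive, division by the [d]-th power would bound the positive power [k - d] of [t.+1]
    uniformly in [t]. *)
Lemma pow_growth_le0 (R : realType) (A C d : R) (k : nat) : d < k%:R ->
  (forall t : nat, t.+1%:R ^+ k * A <= C * t.+1%:R `^ d) -> A <= 0.
Proof.
move=> dk h; rewrite leNgt; apply/negP => A0.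
pose e : R := k%:R - d; have e0 : 0 < e by rewrite subr_gt0.
have he t : t.+1%:R `^ e * A <= C.
  have p : (0 : R) < t.+1%:R `^ d by rewrite powR_gt0.
  rewrite -(ler_pM2r p) [leLHS]mulrAC -powRD; last by rewrite pnatr_eq0 implybT.
  by rewrite /e subrK powR_mulrn.
(* [B] exceeds the bound [C / A]; any [t.+1] above the [e]-th root of [B] contradicts [he]. *)
pose B := C / A + 1.
have C0 : 0 <= C.
  by apply: le_trans (he 0%N); rewrite mulr_ge0 ?powR_ge0 // ltW.
have B0 : 0 <= B by rewrite addr_ge0 // divr_ge0 // ltW.
have [t ht] : exists t : nat, B `^ e^-1 <= t.+1%:R.
  exists (Num.bound (B `^ e^-1)); apply: ltW.
  by apply: (lt_trans (archi_boundP (powR_ge0 _ _))); rewrite ltr_nat.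
have : B <= t.+1%:R `^ e.
  rewrite (_ : B = (B `^ e^-1) `^ e); last first.
    by rewrite -powRrM mulVf ?lt0r_neq0 // powRr1.
  by apply: ge0_ler_powR; rewrite ?nnegrE ?powR_ge0 //; exact: ltW.
rewrite -(ler_pM2r A0) => /le_trans /(_ (he t)).
by rewrite /B mulrDl divfK ?lt0r_neq0 // mul1r; lra.
Qed.

Section Liouville.
Variables (R : realType) (G : zmodType) (S : seq G).
Implicit Types (u v f : G -> R) (x s : G) (k n t : nat).

Lemma iter_laplacian_sum n (I : Type) (r : seq I) (F : I -> G -> R) :
  iter_laplacian n S (fun x => \sum_(i <- r) F i x) =
  fun x => \sum_(i <- r) iter_laplacian n S (F i) x.
Proof.
elim: n => //= n ->; apply/funext => x; rewrite /laplacian exchange_big /=.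
by apply: eq_bigr => s _; rewrite sumrB.
Qed.

Lemma iter_laplacianZ n (a : R) u :
  iter_laplacian n S (fun x => a * u x) = fun x => a * iter_laplacian n S u x.
Proof.
elim: n => //= n ->; apply/funext => x; rewrite /laplacian mulr_sumr.
by apply: eq_bigr => s _; rewrite mulrBr.
Qed.

(** The cross terms add up to [2 * u x * laplacian S u x], which vanishes. *)
Lemma laplacian_sqr u : (forall x, laplacian S u x = 0) ->
  laplacian S (fun x => u x ^+ 2) = fun x => \sum_(s <- S) fdiff s u x ^+ 2.
Proof.
move=> hu; apply/funext => x; apply/eqP; rewrite -subr_eq0 -sumrB.
rewrite (eq_bigr (fun s => 2 * u x * fdiff s u x)); last first.
  by move=> s _; rewrite /fdiff; ring.
by rewrite -mulr_sumr [X in _ * X](hu x) mulr0.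
Qed.

Lemma iter_laplacian_sqrS k u : (forall x, laplacian S u x = 0) ->
  forall x, iter_laplacian k.+1 S (fun x => u x ^+ 2) x =
  \sum_(s <- S) iter_laplacian k S (fun x => fdiff s u x ^+ 2) x.
Proof.
by move=> hu x; rewrite iter_laplacianSr laplacian_sqr // iter_laplacian_sum.
Qed.

Lemma harmonic_fdiff s u : (forall x, laplacian S u x = 0) ->
  forall x, laplacian S (fdiff s u) x = 0.
Proof. by move=> hu x; rewrite -fdiff_laplacian /fdiff !hu subrr. Qed.

Lemma iter_laplacian_sqr_ge0 k u : (forall x, laplacian S u x = 0) ->
  forall x, 0 <= iter_laplacian k S (fun x => u x ^+ 2) x.
Proof.
elim: k u => [|k IH] u hu x; first exact: sqr_ge0.
by rewrite iter_laplacian_sqrS // sumr_ge0 // => s _; exact/IH/harmonic_fdiff.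
Qed.

(** By [iter_laplacian_sqrS] a sum of nonnegative terms, one per generator, is zero; so each term
    vanishes and the induction applies to [fdiff s u]. *)
Lemma iter_laplacian_sqr_eq0 k u : generates S ->
  (forall x, laplacian S u x = 0) ->
  (forall x, iter_laplacian k S (fun x => u x ^+ 2) x = 0) -> degree_lt k u.
Proof.
move=> gS; elim: k u => [|k IH] u hu h.
  by move=> x; apply/eqP; rewrite -sqrf_eq0; apply/eqP/h.
apply: (degree_lt_generators gS) => s sS; apply: IH => [|x].
  exact: harmonic_fdiff.
have /eqP := h x; rewrite iter_laplacian_sqrS // psumr_eq0.
  by move=> /allP /(_ s sS) /eqP.
by move=> r _; apply/iter_laplacian_sqr_ge0/harmonic_fdiff.
Qed.

(** One step of the simple random walk, written as [1 + L / |S|] so that its powers expand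
    binomially in [L]. *)
Definition walk_mean f : G -> R :=
  fun x => f x + (size S)%:R^-1 * laplacian S f x.

Lemma walk_meanE f x : S != [::] ->
  walk_mean f x = (size S)%:R^-1 * \sum_(s <- S) f (x + s).
Proof.
move=> S0; rewrite /walk_mean /laplacian sumrB mulrBr.
rewrite big_const_seq count_predT iter_addr addr0 -[f x *+ _]mulr_natl mulKf.
  by rewrite addrC subrK.
by rewrite pnatr_eq0 size_eq0.
Qed.

Lemma iter_walk_mean_lin t (a : R) f g :
  iter t walk_mean (fun x => f x + a * g x) =
  fun x => iter t walk_mean f x + a * iter t walk_mean g x.
Proof.
elim: t => //= t ->; apply/funext => x; rewrite /walk_mean /laplacian.
rewrite (eq_bigr (fun s =>
  (iter t walk_mean f (x + s) - iter t walk_mean f x) +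
  a * (iter t walk_mean g (x + s) - iter t walk_mean g x))).
  by rewrite big_split /= -mulr_sumr; ring.
by move=> s _; ring.
Qed.

(* The binomial expansion of [(1 + L / |S|) ^ t] has only nonnegative terms. *)
Lemma iter_walk_mean_ge t k f x : (forall j x, 0 <= iter_laplacian j S f x) ->
  'C(t, k)%:R * ((size S)%:R^-1 ^+ k * iter_laplacian k S f x) <=
  iter t walk_mean f x.
Proof.
elim: t k f => [|t IH] k f hf.
  by case: k => [|k]; rewrite ?bin0 ?bin0n ?mul1r ?expr0 ?mul0r; last exact: (hf 0%N).
have hLf j y : 0 <= iter_laplacian j S (laplacian S f) y.
  by rewrite -iter_laplacianSr.
rewrite iterSr (_ : walk_mean f = fun y => f y + (size S)%:R^-1 * laplacian S f y) //.
rewrite iter_walk_mean_lin; set c := _^-1.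
have c0 : 0 <= c by rewrite invr_ge0.
case: k => [|k].
  have := IH 0%N f hf; have := IH 0%N _ hLf; rewrite !bin0 !expr0 !mul1r /=.
  move=> h1 h2; apply: le_trans h2 _; rewrite lerDl mulr_ge0 //.
  by apply: le_trans h1; exact: (hLf 0%N).
rewrite binS natrD mulrDl; apply: lerD; first exact: IH.
apply: le_trans (ler_wpM2l c0 (IH k _ hLf)).
by rewrite iter_laplacianSr exprS -/c le_eqVlt; apply/orP; left; apply/eqP; ring.
Qed.

Variable N : G -> nat.
Hypothesis N_step : forall x s, s \in S -> (N (x + s) <= (N x).+1)%N.

(** A step raises [N] by at most one, so each averaging shifts the argument of the bound by one. *)
Lemma iter_walk_mean_le t (C : R) (M e : nat) f : S != [::] -> 0 <= C ->
  (forall x, f x <= C * ((N x + M)%:R) ^+ e) ->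
  forall x, iter t walk_mean f x <= C * ((N x + M + t)%:R) ^+ e.
Proof.
move=> S0 C0 hf; elim: t => [|t IH] x; first by rewrite addn0.
have sz : (0 : R) < (size S)%:R by rewrite ltr0n lt0n size_eq0.
rewrite iterS walk_meanE // ler_pdivrMl //.
apply: (@le_trans _ _ (\sum_(s <- S) C * (N x + M + t.+1)%:R ^+ e)); last first.
  by rewrite big_const_seq count_predT iter_addr addr0 mulr_natl.
rewrite big_seq [leRHS]big_seq; apply: ler_sum => s sS.
apply: le_trans (IH _) _; rewrite ler_wpM2l //.
rewrite lerXn2r ?nnegrE // ler_nat addnS -!addSn !leq_add2r.
exact: N_step.
Qed.

End Liouville.

(** * Degree bounds from polynomial growth *)

Section PolynomialGrowth.
Variables (R : realType) (G : zmodType) (S : seq G) (b : G).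
Hypothesis symS : symmetric_generating S.
Implicit Types (u v : G -> R) (x s : G) (k n : nat).

(** The binomial lower bound for the walk means of [u ^ 2] is played against their growth; [k] is
    one more than the growth exponent [2 e] of [u ^ 2]. *)
Lemma harmonic_growth_degree e u : growth S b e%:R u ->
  (forall x, laplacian S u x = 0) -> degree_lt (2 * e).+1 u.
Proof.
move=> /(growth_pos symS)[C C0 hC] hu; set k := (2 * e).+1.
have gS := symS.1.
have [S0|S0] := eqVneq S [::].
  by apply: (degree_lt_generators gS) => s; rewrite {1}S0.
apply: (iter_laplacian_sqr_eq0 gS hu) => x; apply/eqP.
rewrite eq_le (iter_laplacian_sqr_ge0 k hu) andbT.
set A := iter_laplacian _ _ _ _; pose c : R := (size S)%:R^-1.
have c0 : 0 < c by rewrite invr_gt0 ltr0n lt0n size_eq0.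
rewrite -(pmulr_rle0 _ (exprn_gt0 k c0)).
have bound t : 'C(t, k)%:R * (c ^+ k * A) <=
    C ^+ 2 * (word_dist S b x + 1 + t)%:R ^+ (2 * e).
  apply: le_trans (@iter_walk_mean_ge _ _ _ t k _ x _) _.
    by move=> j y; exact: iter_laplacian_sqr_ge0.
  apply: (iter_walk_mean_le (N := word_dist S b)) => //.
  - by move=> y s; apply: word_dist_step.
  - exact: exprn_ge0.
  move=> y; rewrite [(2 * e)%N]mulnC exprM -exprMn -real_normK ?num_real //.
  rewrite lerXn2r ?nnegrE ?mulr_ge0 ?exprn_ge0 //.
  by apply: le_trans (hC y) _; rewrite powR_mulrn ?addr_ge0 // natrD.
(* [K] comes from [N + 1 + k + t <= (N + 1 + k) * (t + 1)]; the factorial clears the denominator of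
   the binomial coefficient. *)
pose K := C ^+ 2 * (word_dist S b x + 1 + k)%:R ^+ (2 * e).
apply: (@pow_growth_le0 _ _ (k`!%:R * K) (2 * e)%:R k); first by rewrite ltr_nat.
(* With [k + t] steps the falling factorial is at least [t.+1 ^ k]. *)
move=> t; have := bound (k + t)%N.
rewrite powR_mulrn // -(ler_pM2l (_ : 0 < k`!%:R)) ?ltr0n ?fact_gt0 //.
rewrite [leLHS]mulrA -natrM mulnC bin_ffact => h.
apply: (@le_trans _ _ (((k + t) ^_ k)%:R * (c ^+ k * A))).
  rewrite ler_wpM2r -?natrX ?ler_nat ?expn_leq_ffact //.
  by rewrite mulr_ge0 ?exprn_ge0 ?(ltW c0) // iter_laplacian_sqr_ge0.
apply: le_trans h _; rewrite /K -!mulrA ler_wpM2l ?ler0n // !ler_wpM2l //.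
rewrite -exprMn lerXn2r ?nnegrE ?mulr_ge0 // -natrM ler_nat.
by nia.
Qed.

(* Once [L^(n-1) u] has been shown to be polynomial, its iterated differences
   vanish, so those of [u] are [(n-1)]-polyharmonic. *)
Lemma polyharmonic_growth_degree n e u : growth S b e%:R u ->
  (forall x, iter_laplacian n S u x = 0) -> degree_lt (n * (2 * e).+1) u.
Proof.
elim: n u => [|n IH] u gu hu; first by [].
have : degree_lt (2 * e).+1 (iter_laplacian n S u).
  by apply: harmonic_growth_degree => //; apply: growth_iter_laplacian.
rewrite [(n.+1 * _)%N]mulSn; move: (n * _)%N IH => m IH; move: (2 * e).+1 => k.
move: gu; elim: k u {hu} => [|j IHj] u gu /= hu; first exact: IH.
move=> s; apply: IHj => [|]; first exact: growth_fdiff.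
by rewrite -fdiff_iter_laplacian.
Qed.

Lemma degree_lt_foldP k u : degree_lt k u <->
  forall l, size l = k -> forall x, foldl (fun v s => fdiff s v) u l x = 0.
Proof.
elim: k u => [|k IH] u /=.
  by split=> [h l /size0nil -> //|h]; exact: (h [::]).
split=> [h [//|s l] /= [szl]|h s]; first by have [H _] := IH (fdiff s u); exact: H.
by apply/IH => l szl; apply: (h (s :: l)); rewrite /= szl.
Qed.

Lemma degree_lt_foldl l j u : degree_lt (size l + j) u ->
  degree_lt j (foldl (fun v s => fdiff s v) u l).
Proof. by elim: l u => //= s l IH u h; apply: IH; exact: h. Qed.

Lemma fdiff_foldl s l u : fdiff s (foldl (fun v t => fdiff t v) u l) =
  foldl (fun v t => fdiff t v) (fdiff s u) l.
Proof. by elim: l u => //= t l IH u; rewrite IH fdiffC. Qed.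

(** Second differences vanish, so [fdiff s u] is translation invariant and the increments along
    multiples of [s] add up. *)
Lemma fdiff_mulrn u s t x : degree_lt 2 u ->
  fdiff (s *+ t) u x = t%:R * fdiff s u x.
Proof.
move=> hu; elim: t => [|t IH]; first by rewrite mulr0n mul0r /fdiff addr0 subrr.
have := hu s (s *+ t) x; rewrite {1}/fdiff => /eqP; rewrite subr_eq0 => /eqP E.
by rewrite -natr1 mulrDl mul1r -IH -E mulrSr /fdiff addrA; ring.
Qed.

(* The differences along [t s_1, ..., t s_k] scale like [t ^ k] on functions
   whose [k]-fold differences are constant. *)
Lemma foldl_fdiff_mulrn t l u x : degree_lt (size l).+1 u ->
  foldl (fun v s => fdiff (s *+ t) v) u l x =
  t%:R ^+ size l * foldl (fun v s => fdiff s v) u l x.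
Proof.
elim: l u x => [|s l IH] u x hu; first by rewrite expr0 mul1r.
rewrite /= IH; last exact: hu.
rewrite -!fdiff_foldl fdiff_mulrn ?exprSr ?mulrA //.
by apply: degree_lt_foldl; rewrite addn2.
Qed.

(** Each difference doubles the constant and moves the argument by at most [t] times the length of
    the shift. So [c] is the total word length of [l], independent of [t], [C], [M] and [u]. *)
Lemma foldl_fdiff_growth d l : 0 <= d -> exists c : nat,
  forall t (C : R) M u, 0 <= C ->
  (forall x, `|u x| <= C * ((word_dist S b x + M)%:R) `^ d) ->
  forall x, `|foldl (fun v s => fdiff (s *+ t) v) u l x| <=
    2 ^+ size l * C * ((word_dist S b x + M + t * c)%:R) `^ d.
Proof.
move=> d0; elim: l => [|s l [c hc]].
  by exists 0%N => t C M u C0 hu x; rewrite muln0 addn0 expr0 mul1r; exact: hu.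
exists (word_dist S 0 s + c)%N => t C M u C0 hu x /=.
have h2C : 0 <= 2 * C by rewrite mulr_ge0.
have H := hc t (2 * C) (M + t * word_dist S 0 s)%N (fdiff (s *+ t) u) h2C.
apply: le_trans (H _ x) _; last first.
  have -> : 2 ^+ (size l).+1 * C = 2 ^+ size l * (2 * C) by rewrite exprS; ring.
  by rewrite mulnDr !addnA.
move=> y.
rewrite -[leRHS]mulrA mulr_natl mulr2n.
apply: le_trans (ler_normB _ _) _; apply: lerD.
  apply: le_trans (hu _) _; rewrite ler_wpM2l //.
  rewrite ge0_ler_powR ?nnegrE // ler_nat.
  have := word_distD symS b y (s *+ t); have := word_dist_mulrn symS s t; lia.
apply: le_trans (hu _) _; rewrite ler_wpM2l //.
by rewrite ge0_ler_powR ?nnegrE // ler_nat addnA leq_addr.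
Qed.

(** Scaling all shifts by [t.+1] multiplies a [k]-fold difference by [t.+1 ^ k], while growth allows
    only order [t.+1 ^ d] with [d < k]. *)
Lemma degree_lt_growth_drop d k u : 0 <= d -> d < k%:R -> growth S b d u ->
  degree_lt k.+1 u -> degree_lt k u.
Proof.
move=> d0 dk /(growth_pos symS)[C C0 hC] hu; apply/degree_lt_foldP => l szl x.
have [c hc] := foldl_fdiff_growth l d0.
set A := foldl _ _ _ _; suff : `|A| <= 0 by rewrite normr_le0 => /eqP.
set n := word_dist S b x.
apply: (@pow_growth_le0 _ _ (2 ^+ k * C * (n + 1 + c)%:R `^ d) d k dk) => t.
rewrite (_ : _ * `|A| = `|t.+1%:R ^+ size l * A|); last first.
  by rewrite normrM szl ger0_norm ?exprn_ge0.
rewrite /A -foldl_fdiff_mulrn ?szl //; apply: le_trans (hc t.+1 C 1%N u C0 _ x) _.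
  by move=> y; rewrite natrD; exact: hC.
rewrite szl -mulrA [leRHS]mulrAC -!mulrA ler_wpM2l ?exprn_ge0 // ler_wpM2l //.
rewrite mulrC -powRM // ge0_ler_powR ?nnegrE ?mulr_ge0 // -natrM ler_nat -/n.
by nia.
Qed.

(** Rounding [d] up to an integer gives a crude degree bound, which is lowered one unit at a time
    down to [[d] + 1]. Conversely, degree [<= [d]] gives growth of exponent [[d] <= d]. *)
Lemma polyharmonic_spaceP n (d : R) u : 0 <= d ->
  polyharmonic_space n d S b u <->
  (forall x, iter_laplacian n S u x = 0) /\ degree_lt `|Num.floor d|.+1 u.
Proof.
move=> d0; set k := `|Num.floor d|%N.
have fk : Num.floor d = k%:Z by rewrite /k gez0_abs // floor_ge0.
have kd : k%:R <= d by have := floor_le d; rewrite fk.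
have dk : d < k.+1%:R by have := floorD1_gt d; rewrite fk intrD natr1.
split=> [[Lu gu]|[Lu hu]]; split=> //.
  have ge : growth S b k.+1%:R u.
    case/(growth_pos symS): gu => C C0 hC; exists C => x.
    apply: le_trans (hC x) _; rewrite ler_wpM2l // ler_powR ?lerDr //; exact: ltW.
  have := polyharmonic_growth_degree ge Lu; move: (n * _)%N => K.
  have [Kk|/ltnW kK] := leqP K k.+1; first exact: degree_lt_leq.
  rewrite -(subnK kK); elim: (K - k.+1)%N => [|j IH]; first by rewrite add0n.
  move=> /degree_lt_growth_drop h; apply: IH; apply: h gu => //.
  by apply: lt_le_trans dk _; rewrite ler_nat leq_addl.
have /(growth_pos symS)[C C0 hC] := degree_lt_growth b symS hu.
exists C => x; apply: le_trans (hC x) _.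
by rewrite ler_wpM2l // ler_powR // lerDr.
Qed.

End PolynomialGrowth.

(** * Newton polynomials on Z^m *)

Section NewtonBasis.
Variables (R : realType) (m : nat).
Notation Zm := 'rV[int]_m.
Implicit Types (f g : Zm -> R) (al be : 'I_m -> nat) (j : 'I_m) (k : nat).

Local Notation D j := (@fdiff R _ (delta_mx 0 j : Zm)).

Lemma generates_delta_mx :
  generates [seq (delta_mx 0 j : Zm) | j <- enum 'I_m].
Proof.
move=> H [H0 HB] HS x.
have HN y : y \in H -> - y \in H by move=> yH; rewrite -sub0r HB.
have HD y z : y \in H -> z \in H -> y + z \in H.
  by move=> yH zH; rewrite -[z]opprK HB ?HN.
have Hn y (n : nat) : y \in H -> y *+ n \in H.
  by move=> yH; elim: n => [|n IH]; rewrite ?mulr0n // mulrS HD.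
rewrite (row_sum_delta x); apply: (big_ind (fun y => y \in H)) => // j _.
have dH : delta_mx 0 j \in H by apply: HS; apply: map_f; rewrite mem_enum.
case: (x 0 j) => n; first by rewrite -[Posz n]natz scaler_nat Hn.
by rewrite NegzE scaleNr -[Posz _]natz scaler_nat HN ?Hn.
Qed.

Lemma degree_lt_delta k f : (forall j, degree_lt k (D j f)) -> degree_lt k.+1 f.
Proof.
move=> h; apply: (degree_lt_generators generates_delta_mx) => s.
by case/mapP => j _ ->.
Qed.

(** Coordinate differences commute, so the order of the enumeration is immaterial. *)
Definition mixed_diff al f : Zm -> R :=
  foldr (fun j => iter (al j) (D j)) f (enum 'I_m).

Definition newton_coef al f : R := mixed_diff al f 0.

Definition incr al j : 'I_m -> nat := fun i => (al i + (i == j))%N.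

Lemma incr_pred al j : (0 < al j)%N -> al = incr (fun i => al i - (i == j))%N j.
Proof.
move=> aj; apply/funext => i; rewrite /incr; case: eqP => [->|_].
  by rewrite subnK.
by rewrite addn0 subn0.
Qed.

Lemma sum_incr al j : (\sum_i incr al j i = (\sum_i al i).+1)%N.
Proof.
rewrite big_split /= -addn1; congr addn.
by rewrite (bigD1 j) //= eqxx big1 ?addn0 // => i /negPf ->.
Qed.

Lemma sum_gt0_incr al : (0 < \sum_i al i)%N ->
  exists be j, al = incr be j.
Proof.
move=> h; have [/forallP a0|/forallPn[j aj]] := boolP [forall j, al j == 0%N].
  by rewrite big1 ?ltnn // in h => i _; exact/eqP.
by eexists; exists j; apply: incr_pred; rewrite lt0n.
Qed.

Lemma iter_fdiffC n s t f :
  iter n (fdiff s) (fdiff t f) = fdiff t (iter n (fdiff s) f).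
Proof. by elim: n => //= n ->; rewrite fdiffC. Qed.

Lemma mixed_diff_incr al j f : mixed_diff (incr al j) f = mixed_diff al (D j f).
Proof.
rewrite /mixed_diff.
have comm r : foldr (fun i => iter (al i) (D i)) (D j f) r =
    D j (foldr (fun i => iter (al i) (D i)) f r).
  by elim: r => //= i r ->; rewrite iter_fdiffC.
rewrite comm.
(* [j] occurs exactly once in [enum 'I_m]; the conditional carries this through the induction on the
   list. *)
suff -> : foldr (fun i => iter (incr al j i) (D i)) f (enum 'I_m) =
    (if j \in enum 'I_m then D j else id)
      (foldr (fun i => iter (al i) (D i)) f (enum 'I_m)) by rewrite mem_enum.
elim: (enum _) (enum_uniq 'I_m) => //= i r IH /andP[ir ur].
rewrite IH // inE /incr [j == i]eq_sym; have [<-|ij] := eqVneq i j.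
  by rewrite (negPf ir) addn1.
by rewrite addn0; case: ifP => // _; rewrite iter_fdiffC.
Qed.

Lemma newton_coef_incr al j f :
  newton_coef (incr al j) f = newton_coef al (D j f).
Proof. by rewrite /newton_coef mixed_diff_incr. Qed.

Lemma newton_coef_sum0 al f : (\sum_i al i = 0)%N -> newton_coef al f = f 0.
Proof.
move=> /eqP; rewrite sum_nat_eq0 => /forallP a0; rewrite /newton_coef /mixed_diff.
by elim: (enum _) => //= j r <-; rewrite (eqP (a0 j)).
Qed.

Lemma newton_coef_lincomb (I : Type) (r : seq I) (c : I -> R) (F : I -> Zm -> R)
    al : newton_coef al (fun x => \sum_(i <- r) c i * F i x) =
  \sum_(i <- r) c i * newton_coef al (F i).
Proof.
suff E : mixed_diff al (fun x => \sum_(i <- r) c i * F i x) =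
    fun x => \sum_(i <- r) c i * mixed_diff al (F i) x by rewrite /newton_coef E.
have lin s (H : I -> Zm -> R) : fdiff s (fun x => \sum_(i <- r) c i * H i x) =
    fun x => \sum_(i <- r) c i * fdiff s (H i) x.
  apply/funext => x; rewrite /fdiff -sumrB.
  by apply: eq_bigr => i _; rewrite mulrBr.
rewrite /mixed_diff; elim: (enum _) => //= j l ->.
by elim: (al j) => //= n ->; rewrite lin.
Qed.

Lemma newton_coef0 al : newton_coef al (fun=> 0 : R) = 0.
Proof.
have := newton_coef_lincomb [::] (fun=> 0) (fun i : 'I_m => fun=> 0) al.
by rewrite !big_nil.
Qed.

Lemma newton_coef_ge k al f : degree_lt k f -> (k <= \sum_i al i)%N ->
  newton_coef al f = 0.
Proof.
elim: k al f => [|k IH] al f hf.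
  by move=> _; rewrite (_ : f = fun=> 0) ?newton_coef0 //; apply/funext.
move=> ka; have [|be [j E]] := @sum_gt0_incr al; first exact: leq_ltn_trans ka.
move: ka; rewrite E sum_incr ltnS newton_coef_incr => kb.
by apply: IH => //; exact: hf.
Qed.

(** The coordinate differences of [f] have lower degree and inherit zero coefficients, so [f] is
    constant; its value at [0] is the coefficient of index zero. *)
Lemma newton_coef_inj k f : degree_lt k f ->
  (forall al, newton_coef al f = 0) -> forall x, f x = 0.
Proof.
elim: k f => [|k IH] f // hf h x.
have cst := fdiff_eq0_generators generates_delta_mx (u := f).
rewrite (cst _ x 0) => [|s /mapP[j _ ->]].
  by have := h (fun=> 0%N); rewrite newton_coef_sum0 // big1.
by apply: IH => [|al]; [exact: hf | rewrite -newton_coef_incr].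
Qed.

(** The binomial coefficient [z (z - 1) ... (z - a + 1) / a!], for negative [z] as well. *)
Definition int_binomial (z : int) (a : nat) : R :=
  (\prod_(i < a) (z%:~R - i%:R)) / a`!%:R.

Lemma int_binomialS z a :
  int_binomial (z + 1) a.+1 - int_binomial z a.+1 = int_binomial z a.
Proof.
rewrite /int_binomial big_ord_recl big_ord_recr /=.
rewrite (eq_bigr (fun i : 'I_a => z%:~R - i%:R)); last first.
  by move=> i _; rewrite /bump /= intrD add1n -natr1; ring.
rewrite factS natrM intrD subr0; move: (\prod_(i < a) _) => P.
have a0 : a.+1%:R != 0 :> R by rewrite pnatr_eq0.
have f0 : a`!%:R != 0 :> R by rewrite pnatr_eq0 -lt0n fact_gt0.
by field; rewrite f0 /= -natr1 addrC in a0 *; rewrite a0.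
Qed.

Lemma int_binomial0 a : int_binomial 0 a = (a == 0%N)%:R.
Proof.
case: a => [|a]; first by rewrite /int_binomial big_ord0 fact0 divr1.
by rewrite /int_binomial big_ord_recl subrr !mul0r.
Qed.

Definition newton al : Zm -> R := fun z => \prod_j int_binomial (z 0 j) (al j).

Lemma fdiff_newton_incr al j : D j (newton (incr al j)) = newton al.
Proof.
apply/funext => z; rewrite /fdiff /newton (bigD1 j) //= [X in _ - X](bigD1 j) //=.
rewrite /incr eqxx addn1.
rewrite !mxE !eqxx /= [(1 : int)]mulr1n.
rewrite (eq_bigr (fun i => int_binomial (z 0 i) (al i))); last first.
  by move=> i /negPf ij; rewrite ij !mxE ij andbF addr0 addn0.
rewrite [X in _ - _ * X](eq_bigr (fun i => int_binomial (z 0 i) (al i))).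
  by rewrite -mulrBl int_binomialS [RHS](bigD1 j).
by move=> i /negPf ij; rewrite ij addn0.
Qed.

Lemma fdiff_newton0 al j : al j = 0%N -> D j (newton al) = fun=> 0.
Proof.
move=> aj; apply/funext => z; apply/eqP; rewrite /fdiff subr_eq0; apply/eqP.
apply: eq_bigr => i _; have [->|ij] := eqVneq i j.
  by rewrite aj /int_binomial !big_ord0.
by rewrite !mxE (negPf ij) andbF addr0.
Qed.

(** Induction on the order of [be]: a difference along [j] lowers both indices at [j], or kills
    [newton al] when [al j = 0]. *)
Lemma newton_coef_newton be al :
  newton_coef be (newton al) = [forall i, be i == al i]%:R.
Proof.
move: {2}(\sum_i be i)%N (erefl (\sum_i be i)%N) => n.
elim: n be al => [|n IH] be al hn.
  rewrite newton_coef_sum0 // /newton.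
  move/eqP: hn; rewrite sum_nat_eq0 => /forallP b0.
  rewrite (eq_bigr (fun i => (be i == al i)%:R)); last first.
    by move=> i _; rewrite mxE int_binomial0 (eqP (b0 i)) eq_sym.
  have [/forallP h|/forallPn[i /negPf hi]] := boolP [forall i, be i == al i].
    by rewrite big1 // => i _; rewrite h.
  by rewrite (bigD1 i) //= hi mul0r.
have [|be' [j E]] := @sum_gt0_incr be; first by rewrite hn.
move: hn; rewrite E sum_incr newton_coef_incr => -[hn].
have [aj|aj] := posnP (al j).
  rewrite fdiff_newton0 // newton_coef0.
  have [/forallP /(_ j)|//] := boolP [forall i, incr be' j i == al i].
  by rewrite aj /incr eqxx addn1.
rewrite (incr_pred aj) fdiff_newton_incr IH //; congr (nat_of_bool _)%:R.
by apply: eq_forallb => i; rewrite [in RHS]/incr eqn_add2r.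
Qed.

Lemma degree_lt_newton k al : (\sum_i al i < k)%N -> degree_lt k (newton al).
Proof.
elim: k al => // k IH al hk; apply: degree_lt_delta => j.
have [aj|aj] := posnP (al j); first by rewrite fdiff_newton0 //; exact: degree_lt0.
by move: hk; rewrite (incr_pred aj) sum_incr fdiff_newton_incr; exact: IH.
Qed.

Lemma is_polynomial_newton_sum (I : Type) (r : seq I) (c : I -> R)
    (al : I -> 'I_m -> nat) :
  is_polynomial_function (fun z => \sum_(i <- r) c i * newton (al i) z).
Proof.
pose C (a : R) := mpoly.mpolyC m a.
pose X j := mpoly.mpolyX R (mpoly.mnm1 j).
exists (\sum_(i <- r) C (c i) * \prod_j
  ((\prod_(t < al i j) (X j - C t%:R)) * C ((al i j)`!%:R^-1))) => z.
rewrite (raddf_sum (mpoly.meval _)); apply: eq_bigr => i _ /=.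
rewrite mpoly.mevalM mpoly.mevalC; congr (_ * _).
rewrite (rmorph_prod (mpoly.meval _)); apply: eq_bigr => j _ /=.
rewrite mpoly.mevalM mpoly.mevalC; congr (_ / _).
rewrite (rmorph_prod (mpoly.meval _)); apply: eq_bigr => t _ /=.
by rewrite mpoly.mevalB mpoly.mevalXU mpoly.mevalC.
Qed.

End NewtonBasis.

(** * Initial data for polyharmonic polynomials *)

Section InitialData.
Variables (R : realType) (m : nat) (i0 : 'I_m) (S : seq 'rV[int]_m).
Notation Zm := 'rV[int]_m.
Implicit Types (f g : Zm -> R) (s : Zm) (j : 'I_m) (k n : nat).
Hypothesis symS : symmetric_generating S.

Local Notation D j := (@fdiff R _ (delta_mx 0 j : Zm)).

(** Such an [f] depends on the coordinate [i0] alone. *)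
Let univariate f := forall j, j != i0 -> D j f = fun=> 0.

Lemma fdiff0 (G : zmodType) (s : G) : fdiff s (fun=> 0 : R) = fun=> 0.
Proof. by apply/funext => x; rewrite /fdiff subrr. Qed.

Lemma univariate_fdiff s f : univariate f -> univariate (fdiff s f).
Proof. by move=> hf j ji; rewrite fdiffC hf // fdiff0. Qed.

Lemma degree_lt_univariate k f : univariate f ->
  degree_lt k (D i0 f) -> degree_lt k.+1 f.
Proof.
move=> hf hk; apply: degree_lt_delta => j.
by have [->//|ji] := eqVneq j i0; rewrite hf //; exact: degree_lt0.
Qed.

(** First differences of [g] are constant, so the shifts obeying the formula form a subgroup; it
    contains the coordinate vectors. *)
Lemma fdiff_univariate s g x : univariate g -> degree_lt 2 g ->
  fdiff s g x = (s 0 i0)%:~R * D i0 g x.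
Proof.
move=> ug hg.
have cst r y z : fdiff r g y = fdiff r g z.
  have := hg r (z - y) y; rewrite {1}/fdiff (addrC y) subrK.
  by move=> /eqP; rewrite subr_eq0 => /eqP.
pose P := [pred r : Zm | `[< forall y, fdiff r g y = (r 0 i0)%:~R * D i0 g x >]].
suff: s \in P by move=> /asboolP /(_ x).
apply: (@generates_delta_mx m P) => [|r].
  split=> [|r t /asboolP hr /asboolP ht]; apply/asboolP => y.
    by rewrite mxE mul0r /fdiff addr0 subrr.
  rewrite !mxE intrB mulrBl -(hr (y - t)) -(ht (y - t)) /fdiff subrK.
  by rewrite (addrA y) (addrAC y); ring.
case/mapP => j _ ->; apply/asboolP => y; rewrite mxE eqxx /=.
have [->|ji] := eqVneq i0 j; first by rewrite mul1r (cst _ y x).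
by rewrite ug ?mul0r // eq_sym.
Qed.

(** By induction the third difference vanishes, so second differences are constant and [2 L f] is
    [D i0 (D i0 f)] times the sum of the [(s 0 i0)^2], which is positive. *)
Lemma univariate_harmonic k f : (exists2 s, s \in S & s 0 i0 != 0) ->
  univariate f -> degree_lt k f -> (forall x, laplacian S f x = 0) ->
  D i0 (D i0 f) = fun=> 0.
Proof.
move=> [s1 s1S s10]; elim: k f => [|k IH] f uf hk hL.
  by rewrite (_ : f = fun=> 0) ?fdiff0 //; apply/funext.
have h3 : degree_lt 3 f.
  have u1 := univariate_fdiff (delta_mx 0 i0) uf.
  have u2 := univariate_fdiff (delta_mx 0 i0) u1.
  apply: (degree_lt_univariate uf); apply: (degree_lt_univariate u1).
  apply: (degree_lt_univariate u2) => x.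
  by rewrite (IH _ u1 (hk _) (harmonic_fdiff _ hL)).
apply/funext => x.
have := laplacian_diff2 symS f x; rewrite hL mul0rn => /esym /eqP.
rewrite oppr_eq0 (eq_bigr (fun s => - (s 0 i0)%:~R ^+ 2 * D i0 (D i0 f) x)).
  rewrite -mulr_suml sumrN mulNr oppr_eq0 mulf_eq0 => /orP[|/eqP//].
  rewrite psumr_eq0 => [/allP /(_ _ s1S)|s _]; last exact: sqr_ge0.
  by rewrite /= sqrf_eq0 intr_eq0 (negPf s10).
move=> s _; rewrite fdiff_univariate; [|exact: univariate_fdiff|exact: h3].
rewrite fdiffC fdiff_univariate; [|exact: univariate_fdiff|exact: h3].
by rewrite mxE intrN; ring.
Qed.

(** By induction applied to [L f], the [2 n]-fold difference of [f] along [i0] is harmonic; two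
    further differences kill it. *)
Lemma univariate_polyharmonic n k f : (exists2 s, s \in S & s 0 i0 != 0) ->
  univariate f -> degree_lt k f -> (forall x, iter_laplacian n S f x = 0) ->
  forall x, iter (2 * n) (D i0) f x = 0.
Proof.
move=> hS; elim: n f k => [|n IH] f k uf hk hL //.
have uL : univariate (laplacian S f).
  move=> j ji; rewrite fdiff_laplacian uf //.
  by apply/funext => x; rewrite /laplacian big1 // => s _; rewrite subrr.
have hLk : degree_lt k (laplacian S f).
  by apply: degree_lt_laplacian => //; do 2!apply: degree_ltW.
have iterL q g : iter q (D i0) (laplacian S g) = laplacian S (iter q (D i0) g).
  by elim: q => //= q ->; rewrite fdiff_laplacian.
have := IH _ _ uL hLk; rewrite -iter_laplacianSr iterL => /(_ hL) h.
have it q : univariate (iter q (D i0) f) /\ degree_lt k (iter q (D i0) f).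
  elim: q => //= q [uj hj]; split; first exact: univariate_fdiff.
  exact: (degree_ltW hj).
have [u2 h2] := it (2 * n)%N.
by rewrite mulnS => x; rewrite [LHS](congr1 (@^~ x) (univariate_harmonic hS u2 h2 h)).
Qed.

(* A polyharmonic polynomial is determined by its Newton coefficients of order
   [< 2 n] in the direction [i0]: by induction on the degree its differences in
   the other directions vanish, which leaves a problem in one variable. *)
Lemma polyharmonic_initial_data n k f : (exists2 s, s \in S & s 0 i0 != 0) ->
  degree_lt k f -> (forall x, iter_laplacian n S f x = 0) ->
  (forall al, (al i0 < 2 * n)%N -> newton_coef al f = 0) ->
  forall x, f x = 0.
Proof.
move=> hS; elim: k f => [|k IH] f hk hL h0 //.
have uf : univariate f.
  move=> j ji; apply/funext => x; apply: IH => [|y|al hal]; first exact: hk.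
    by rewrite -fdiff_iter_laplacian /fdiff !hL subrr.
  by rewrite -newton_coef_incr h0 // /incr eq_sym (negPf ji) addn0.
have h2n := univariate_polyharmonic hS uf hk hL.
apply: (newton_coef_inj hk) => al.
have [/h0//|] := ltnP (al i0) (2 * n)%N.
(* The remaining coefficients factor through the [2 n]-fold difference along [i0], which is zero by
   [h2n]. *)
elim: (2 * n)%N al f h2n {hk hL h0 uf} => [|q IHq] al f hq ha.
  have -> : f = fun=> 0 by apply/funext.
  exact: newton_coef0.
have a0 : (0 < al i0)%N by exact: leq_ltn_trans ha.
rewrite (incr_pred a0) newton_coef_incr; apply: IHq => [x|].
  by rewrite -iterSr.
by rewrite eqxx; lia.
Qed.

End InitialData.

(** * Dimension *)

(** A row base of the kernel of [M], transported by the free family [e], is a basis; rank-nullity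
    gives its size. *)
Lemma has_dim_ker (K : fieldType) (V : lmodType K) (N N' : nat) (e : 'I_N -> V)
    (M : 'M[K]_(N, N')) :
  (forall c : 'I_N -> K, \sum_i c i *: e i = 0 -> forall i, c i = 0) ->
  has_dim [set u | exists c : 'rV[K]_N, c *m M = 0 /\ u = \sum_i c 0 i *: e i]
    (N - \rank M).
Proof.
move=> free; rewrite -mxrank_ker; set B := row_base (kermx M).
have combE (c : 'I_(\rank (kermx M)) -> K) :
    \sum_i c i *: (\sum_j B i j *: e j) =
    \sum_j ((\row_i c i) *m B) 0 j *: e j.
  under eq_bigr do rewrite scaler_sumr.
  rewrite exchange_big /=; apply: eq_bigr => j _.
  rewrite mxE scaler_suml; apply: eq_bigr => i _.
  by rewrite [X in X * _]mxE scalerA.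
exists (fun i => \sum_j B i j *: e j); split=> [c|].
  rewrite combE => /free c0 i.
  have /eqP : (\row_i c i) *m B = 0 by apply/rowP => j; rewrite c0 mxE.
  rewrite mulmx_free_eq0 ?row_base_free // => /eqP /rowP /(_ i).
  by rewrite !mxE.
apply/seteqP; split=> [u [c [cM ->]]|u [c ->]].
  have : (c <= kermx M)%MS by apply/sub_kermxP.
  rewrite -(eq_row_base (kermx M)) => /submxP[d dE].
  have dd : \row_i d 0 i = d by apply/rowP => i; rewrite mxE.
  by exists (d 0); rewrite combE dd -dE.
exists ((\row_i c i) *m B); split; last by rewrite combE.
by apply/sub_kermxP; rewrite -(eq_row_base (kermx M)) submxMl.
Qed.

(** * Multi-indices of bounded order *)

Section MultiIndices.
Variables (m k : nat).

Definition multi_indices : {set m.-tuple 'I_k.+1} :=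
  [set t : m.-tuple 'I_k.+1 | (\sum_(i <- t) i <= k)%N]%SET.

Definition multi_index (i : 'I_#|multi_indices|) : 'I_m -> nat :=
  fun j => tnth (enum_val i) j.

Lemma sum_multi_index i : (\sum_j multi_index i j <= k)%N.
Proof. by have := enum_valP i; rewrite inE big_tuple. Qed.

Lemma multi_index_eq i i' :
  [forall j, multi_index i j == multi_index i' j] = (i == i').
Proof.
apply/forallP/eqP => [h|-> //]; apply: enum_val_inj.
by apply: eq_from_tnth => j; apply: val_inj; exact/eqP/h.
Qed.

Lemma multi_index_surj (al : 'I_m -> nat) : (\sum_j al j <= k)%N ->
  exists i, multi_index i = al.
Proof.
move=> hal.
have alk j : (al j < k.+1)%N.
  by rewrite ltnS; apply: leq_trans hal; rewrite (bigD1 j) //= leq_addr.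
pose t := [tuple Ordinal (alk j) | j < m].
have tA : t \in multi_indices.
  by rewrite inE big_tuple (eq_bigr al) // => j _; rewrite tnth_mktuple.
exists (enum_rank_in tA t); apply/funext => j.
by rewrite /multi_index enum_rankK_in // tnth_mktuple.
Qed.

End MultiIndices.

(** * The iterated Laplacian in Newton bases *)

Section Dimension.
Variables (R : realType) (m : nat).
Notation Zm := 'rV[int]_m.
Implicit Types (f : Zm -> R) (k n : nat).

Lemma newton_coef_lincomb_newton k (c : 'I_#|multi_indices m k| -> R) al :
  newton_coef al (fun z => \sum_i c i * newton R (multi_index i) z) =
  \sum_i c i * [forall j, al j == multi_index i j]%:R.
Proof.
rewrite newton_coef_lincomb.
by apply: eq_bigr => i _; rewrite newton_coef_newton.
Qed.

Lemma newton_coef_multi_index k (c : 'I_#|multi_indices m k| -> R) i :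
  newton_coef (multi_index i)
    (fun z => \sum_i c i * newton R (multi_index i) z) = c i.
Proof.
rewrite newton_coef_lincomb_newton (bigD1 i) //= multi_index_eq eqxx mulr1.
rewrite big1 ?addr0 // => j ji.
by rewrite multi_index_eq eq_sym (negPf ji) mulr0.
Qed.

Lemma degree_lt_lincomb_newton k (c : 'I_#|multi_indices m k| -> R) :
  degree_lt k.+1 (fun z => \sum_i c i * newton R (multi_index i) z).
Proof.
apply: degree_lt_sum => i _; apply: degree_ltZ; apply: degree_lt_newton.
by rewrite ltnS sum_multi_index.
Qed.

Lemma eq0_multi_index k f : degree_lt k.+1 f ->
  (forall i : 'I_#|multi_indices m k|, newton_coef (multi_index i) f = 0) ->
  forall z, f z = 0.
Proof.
move=> hf h; apply: (newton_coef_inj hf) => al.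
have [hk|/(newton_coef_ge hf)//] := leqP (\sum_i al i)%N k.
by have [i <-] := multi_index_surj hk.
Qed.

Lemma newton_expansion k f : degree_lt k.+1 f -> f =
  fun z => \sum_(i < #|multi_indices m k|)
             newton_coef (multi_index i) f * newton R (multi_index i) z.
Proof.
move=> hf; set g := fun z => _; apply/funext => z; apply/eqP.
(* [f - g] is written as a combination over the booleans so that [newton_coef_lincomb] applies. *)
pose F (b : bool) := if b then f else g.
pose c (b : bool) : R := if b then 1 else -1.
have hE x : \sum_(b <- [:: true; false]) c b * F b x = f x - g x.
  by rewrite !big_cons big_nil /= mul1r mulN1r addr0.
rewrite -subr_eq0 -hE; apply/eqP; move: z; apply: (@eq0_multi_index k).
  apply: degree_lt_sum => b _; apply: degree_ltZ.
  by case: b => //=; exact: degree_lt_lincomb_newton.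
move=> i; rewrite newton_coef_lincomb !big_cons big_nil /= newton_coef_multi_index.
by rewrite mul1r mulN1r addr0 subrr.
Qed.

Variables (S : seq Zm) (i0 : 'I_m).
Hypothesis symS : symmetric_generating S.

(** Otherwise [S] would lie in the proper subgroup [x 0 i0 = 0]. *)
Lemma generators_coord_neq0 : exists2 s, s \in S & s 0 i0 != 0.
Proof.
apply/hasP; apply: contraT => /hasPn h.
have := symS.1 [pred x : Zm | x 0 i0 == 0].
have cl : zmod_closed [pred x : Zm | x 0 i0 == 0].
  split=> [|x y]; rewrite !inE !mxE // => /eqP-> /eqP->; by rewrite subrr.
move=> /(_ cl) H; have := H _ (delta_mx 0 i0).
rewrite inE mxE !eqxx /=; apply=> s /h; rewrite negbK inE; exact.
Qed.

Definition laplacian_mx n k k' : 'M[R]_(#|multi_indices m k|, #|multi_indices m k'|) :=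
  \matrix_(i, j) newton_coef (multi_index j)
                   (iter_laplacian n S (newton R (multi_index i))).

Lemma iter_laplacian_lincomb n (I : Type) (r : seq I) (c : I -> R)
    (F : I -> Zm -> R) :
  iter_laplacian n S (fun z => \sum_(i <- r) c i * F i z) =
  fun z => \sum_(i <- r) c i * iter_laplacian n S (F i) z.
Proof.
rewrite iter_laplacian_sum; apply/funext => z.
by apply: eq_bigr => i _; rewrite iter_laplacianZ.
Qed.

(** [L^n] maps degree [<= k + 2 n] into degree [<= k], so the coefficients recorded in the matrix
    decide whether the image is zero. *)
Lemma laplacian_mxP n k (c : 'rV[R]_#|multi_indices m (k + 2 * n)|) :
  c *m laplacian_mx n _ k = 0 <->
  forall z, iter_laplacian n S
    (fun z => \sum_i c 0 i * newton R (multi_index i) z) z = 0.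
Proof.
set f := fun z => \sum_i _.
have coefE (j : 'I_#|multi_indices m k|) :
    newton_coef (multi_index j) (iter_laplacian n S f) =
    (c *m laplacian_mx n _ k) 0 j.
  rewrite iter_laplacian_lincomb newton_coef_lincomb mxE.
  by apply: eq_bigr => i _; rewrite mxE.
split=> [c0|f0].
  apply: (@eq0_multi_index k) => [|j]; last by rewrite coefE c0 mxE.
  apply: degree_lt_iter_laplacian => //; rewrite addSn.
  exact: degree_lt_lincomb_newton.
apply/rowP => j; rewrite -coefE mxE -[RHS](newton_coef0 R (multi_index j)).
by congr newton_coef; apply/funext.
Qed.

(* On the span of the Newton polynomials of order [>= 2 n] in the direction
   [i0], [L^n] is injective, hence onto the polynomials of degree [<= k]. *)
Lemma rank_laplacian_mx n k :
  \rank (laplacian_mx n (k + 2 * n) k) = #|multi_indices m k|.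
Proof.
apply/eqP; rewrite eqn_leq rank_leq_col /=; set M := laplacian_mx _ _ _.
(* Raising the order along [i0] by [2 * n] embeds the column indices in the row indices and selects
   a square block. *)
pose up (al : 'I_m -> nat) : 'I_m -> nat := fun j => (al j + (j == i0) * (2 * n))%N.
have sum_up al : (\sum_j up al j = \sum_j al j + 2 * n)%N.
  rewrite big_split /=; congr addn.
  by rewrite (bigD1 i0) //= eqxx mul1n big1 ?addn0 // => j /negPf ->.
have /choice[io ioE] : forall j : 'I_#|multi_indices m k|,
    exists i : 'I_#|multi_indices m (k + 2 * n)|,
      multi_index i = up (multi_index j).
  move=> j; apply: multi_index_surj; rewrite sum_up leq_add2r.
  exact: sum_multi_index.
have io_inj : injective io.
  move=> j j' e; apply/eqP; rewrite -multi_index_eq; apply/forallP => i.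
  by have := congr1 (@^~ i) (ioE j); rewrite e ioE /up => /addIn ->.
(* A kernel vector of this block extends by zero to [c]; the polynomial with coefficients [c] is
   polyharmonic without coefficients of order [< 2 * n] along [i0], hence zero. *)
have E : \rank (rowsub io M) = #|multi_indices m k|.
  apply/eqP; rewrite -/(row_free _) -kermx_eq0; apply/rowV0P => v.
  move=> /sub_kermxP vM; pose c := v *m rowsub io 1%:M.
  have cM : c *m M = 0 by rewrite -mulmxA -rowsubE.
  have cE j : c 0 (io j) = v 0 j.
    rewrite mxE (bigD1 j) //= !mxE eqxx mulr1 big1 ?addr0 // => i ij.
    by rewrite !mxE (inj_eq io_inj) (negPf ij) mulr0.
  have c0 i : (multi_index i i0 < 2 * n)%N -> c 0 i = 0.
    move=> hi; rewrite mxE big1 // => j _; rewrite !mxE.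
    have [E|_] := eqVneq (io j) i; last by rewrite mulr0.
    by move: hi; rewrite -E ioE /up eqxx mul1n ltnNge leq_addl.
  have /laplacian_mxP f0 := cM; set f := fun z => _ in f0.
  have fz z : f z = 0.
    apply: (polyharmonic_initial_data symS generators_coord_neq0 _ f0).
      exact: degree_lt_lincomb_newton.
    move=> al hal; rewrite newton_coef_lincomb_newton big1 // => i _.
    have [/forallP h|_] := boolP [forall j, al j == multi_index i j].
      by rewrite c0 ?mul0r // -(eqP (h i0)).
    by rewrite mulr0.
  apply/rowP => j; rewrite mxE -cE -newton_coef_multi_index -/f.
  by rewrite (_ : f = fun=> 0) ?newton_coef0 //; apply/funext.
rewrite (leq_trans (eq_leq (esym E))) // mxrankS // rowsubE; exact: submxMl.
Qed.

End Dimension.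

(** * Binomial counts *)

Lemma card_multi_indices m k : #|multi_indices m k| = 'C(m + k, m).
Proof. by rewrite -card_partial_ord_partitions; apply: eq_card => t; rewrite !inE. Qed.

(** Summed from the top, the terms telescope: [multichoose m r] is ['C(m + r, m)] minus
    ['C(m + r - 1, m)]. *)
Lemma sum_multichoose m k q : (0 < m)%N ->
  (\sum_(0 <= j < q) multichoose m (k%:Z - q%:Z + 1 + j%:Z)%R)%N =
  ('C(m + k, m) - (if q <= k then 'C(m + (k - q), m) else 0))%N.
Proof.
move=> m0; set X := (if _ then _ else _)%N.
(* The additive form avoids truncated subtraction in the induction. *)
suff <- : (\sum_(0 <= j < q) multichoose m (k%:Z - q%:Z + 1 + j%:Z)%R + X)%N
    = 'C(m + k, m) by rewrite addnK.
have -> : (\sum_(0 <= j < q) multichoose m (k%:Z - q%:Z + 1 + j%:Z)%R =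
    \sum_(0 <= j < q) multichoose m (k%:Z - j%:Z)%R)%N.
  rewrite [RHS]big_nat_rev /=; apply: eq_big_nat => j /andP[_ jq].
  by congr multichoose; lia.
rewrite {}/X; elim: q => [|q IH]; first by rewrite big_geq // add0n subn0.
rewrite -{}IH big_nat_recr //= -addnA; congr addn.
have [kq|qk] := ltnP k q.
  have -> : (k%:Z - q%:Z)%R = Negz (q - k).-1 by lia.
  by have -> : (q < k)%N = false by lia.
have -> : (k%:Z - q%:Z)%R = (k - q)%N%:Z by lia.
case: m m0 => // m _; have [kq|kq] := ltnP q k; last first.
  by rewrite (eqP (_ : k - q == 0)%N) ?subn_eq0 // !addn0 binn /= ?bin0.
have -> : (k - q = (k - q.+1).+1)%N by lia.
move: (k - q.+1)%N => r.
have -> : multichoose m.+1 r.+1 = 'C(m + r.+1, r.+1) by [].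
by rewrite [in RHS]addSn binS [(m.+1 + r)%N]addSnnS addnC -(bin_sub (leq_addl m r.+1)) addnK.
Qed.

(** * Dimension of the spaces of polyharmonic polynomials *)

Section PolyharmonicDimension.
Variables (R : realType) (G : zmodType) (m : nat) (S : seq G).
Variables (pi : {additive G -> 'rV[int]_m}) (surj : forall z, exists x, pi x = z).

Definition polyharmonic_polynomials n k : set (G -> R^o) :=
  [set u | exists f : 'rV[int]_m -> R,
     [/\ u = f \o pi, forall x, iter_laplacian n S u x = 0 & degree_lt k u]].

(** [M] stays abstract to cover both the matrix of [L^n] and, in low degree, a matrix without
    columns. *)
Lemma has_dim_polyharmonic_mx n k N' (M : 'M[R]_(#|multi_indices m k|, N')) :
  (forall c : 'rV_#|multi_indices m k|, c *m M = 0 <->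
     forall z, iter_laplacian n (map pi S)
       (fun z => \sum_i c 0 i * newton R (multi_index i) z) z = 0) ->
  has_dim (polyharmonic_polynomials n k.+1) (#|multi_indices m k| - \rank M).
Proof.
move=> hM.
pose e (i : 'I_#|multi_indices m k|) : G -> R^o := newton R (multi_index i) \o pi.
have eE (c : 'I_#|multi_indices m k| -> R) : \sum_i c i *: e i =
    (fun z => \sum_i c i * newton R (multi_index i) z) \o pi.
  by rewrite fct_sumE.
have free (c : 'I_#|multi_indices m k| -> R) :
    \sum_i c i *: e i = 0 -> forall i, c i = 0.
  rewrite eE => h i; rewrite -newton_coef_multi_index.
  rewrite -[RHS](newton_coef0 R (multi_index i)).
  congr newton_coef; apply/funext => z; have [x <-] := surj z.
  by have := congr1 (@^~ x) h.
rewrite (_ : polyharmonic_polynomials n k.+1 =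
  [set u | exists c : 'rV[R]_#|multi_indices m k|,
     c *m M = 0 /\ u = \sum_i c 0 i *: e i]); first exact: has_dim_ker.
apply/seteqP; split=> u.
  move=> [f [-> Lf /(degree_lt_comp _ _ surj) /newton_expansion fE]].
  exists (\row_i newton_coef (multi_index i) f).
  have {}fE : f = fun z => \sum_(i < #|multi_indices m k|)
      (\row_i newton_coef (multi_index i) f) 0 i * newton R (multi_index i) z.
    apply/funext => z; rewrite [LHS](congr1 (@^~ z) fE).
    by apply: eq_bigr => i _; rewrite mxE.
  split; last by rewrite eE -fE.
  apply/hM => z; rewrite -fE; have [x <-] := surj z.
  by have := Lf x; rewrite iter_laplacian_comp.
move=> [c [/hM Lc ->]]; rewrite eE; eexists; split; first reflexivity.
  by move=> x; rewrite iter_laplacian_comp /= Lc.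
by apply/(degree_lt_comp _ _ surj)/degree_lt_lincomb_newton.
Qed.

Lemma has_dim_polyharmonic n k (i0 : 'I_m) : symmetric_generating S ->
  has_dim (polyharmonic_polynomials n k.+1)
    ('C(m + k, m) - (if 2 * n <= k then 'C(m + (k - 2 * n), m) else 0))%N.
Proof.
move=> symS; have symT := symmetric_generating_map surj symS.
have [kn|kn] := leqP (2 * n)%N k.
  rewrite -(subnK kn); move: (k - 2 * n)%N => k'.
  rewrite addnK -!card_multi_indices.
  rewrite -[X in (_ - X)%N](rank_laplacian_mx R i0 symT n).
  by apply: has_dim_polyharmonic_mx => c; exact: laplacian_mxP.
(* In degree [<= k < 2 n] every polynomial is polyharmonic, so no condition is imposed. *)
rewrite -card_multi_indices -(mxrank0 R #|multi_indices m k| 0).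
apply: has_dim_polyharmonic_mx => c; split=> [_|_]; last by rewrite mulmx0.
apply: (degree_lt_iter_laplacian symT (k := 0) (n := n)).
by rewrite add0n; apply: degree_lt_leq kn _; exact: degree_lt_lincomb_newton.
Qed.

End PolyharmonicDimension.

(** * Torsion invariance, transfer to [G1] and the dimension formula *)

Theorem theorem1p5 (R : realType) (m l : nat) (hm : (1 <= m)%N)
    (p a : 'I_l -> nat)
    (hp : forall i, prime (p i)) (ha : forall i, (0 < a i)%N)
    (G1 G2 : zmodType)
    (phi : {additive G1 -> 'rV[int]_m}) (hphi : bijective phi)
    (psi : G2 -> {dffun forall i : 'I_l, 'Z_(p i ^ a i)})
    (hpsi : bijective psi)
    (hpsiD : forall x y i, psi (x + y) i = psi x i + psi y i)
    (S : seq (G1 * G2)) (hS : symmetric_generating S)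
    (n : nat) (hn : (1 <= n)%N) (d : R) (hd : 0 <= d)
    (b : G1 * G2) (b1 : G1) :
  [/\ polyharmonic_space n d S b =
        [set (fun x : G1 * G2 => g x.1)
          | g in polyharmonic_space n d (map fst S) b1],
      forall f : G1 * G2 -> R, polyharmonic_space n d S b f ->
        (forall (x : G1 * G2) (w : G2), f (x + (0, w)) = f x) /\
        exists g : 'rV[int]_m -> R, is_polynomial_function g /\
          forall x : G1 * G2, f x = g (phi x.1)
    & has_dim (polyharmonic_space n d S b : set (G1 * G2 -> R^o))
        (\sum_(0 <= j < 2 * n)
            multichoose m (Num.floor d - (2 * n)%:Z + 1 + j%:Z)%R)%N].
Proof.
set k := `|Num.floor d|%N.
have fk : Num.floor d = k%:Z by rewrite /k gez0_abs // floor_ge0.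
case: (hphi) => phi' phiK phiK'.
have surj1 : forall y, exists x : G1 * G2, fst x = y by move=> y; exists (y, 0).
have surj : forall z, exists x : G1 * G2, (phi \o fst) x = z.
  by move=> z; exists (phi' z, 0); rewrite /= phiK'.
have symS1 : symmetric_generating (map fst S).
  exact: (symmetric_generating_map (pi := fst) surj1 hS).
(* The product of all the orders [p i ^ a i] annihilates [G2], as [degree_lt_torsion] requires. *)
have torsion (w : G2) : w *+ \prod_i (p i ^ a i) = 0.
  apply: (bij_inj hpsi).
  have psi0 i : psi 0 i = 0 by apply: (addrI (psi 0 i)); rewrite -hpsiD !addr0.
  have psiMn q i : psi (w *+ q) i = psi w i *+ q.
    by elim: q => [|q IH]; rewrite ?mulr0n // !mulrS hpsiD IH.
  apply/ffunP => i; rewrite psiMn psi0 (bigD1 i) //= mulrnA.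
  (* ['Z_q] has characteristic [q] only when [q > 1]. *)
  have gt1 : (1 < p i ^ a i)%N by rewrite -(expn0 (p i)) ltn_exp2l ?prime_gt1.
  by rewrite -[X in X *+ _]mulr_natr pchar_Zp // mulr0 mul0rn.
have inv (u : G1 * G2 -> R) : degree_lt k.+1 u -> forall x w, u (x + (0, w)) = u x.
  move=> hu x w; apply: (degree_lt_torsion (q := \prod_i (p i ^ a i)) _ _ hu).
    by rewrite prodn_gt0 // => i; rewrite expn_gt0 prime_gt0.
  have pairMn q : ((0, w) : G1 * G2) *+ q = (0, w *+ q).
    by elim: q => [|q IH]; rewrite ?mulr0n // !mulrS IH; congr pair; rewrite /= addr0.
  by rewrite pairMn torsion.
have fstE (u : G1 * G2 -> R) : degree_lt k.+1 u -> u = (fun x1 => u (x1, 0)) \o fst :> (_ -> R).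
  move=> hu; apply/funext => -[x1 x2] /=.
  by rewrite -[RHS](inv u hu (x1, 0) x2); congr u; congr pair; rewrite /= ?addr0 ?add0r.
have phiE (u : G1 * G2 -> R) : degree_lt k.+1 u ->
    u = (fun z => u (phi' z, 0)) \o (phi \o fst) :> (_ -> R).
  by move=> /fstE {1}->; apply/funext => x /=; rewrite phiK.
split.
- apply/seteqP; split=> u.
    move=> /(polyharmonic_spaceP b hS n _ hd)[Lu hu].
    exists (fun x1 => u (x1, 0)); last by rewrite [RHS]fstE.
    apply/(polyharmonic_spaceP b1 symS1 n _ hd); split=> [x1|].
      have := Lu (x1, 0); rewrite {1}(fstE u hu).
      by rewrite (iter_laplacian_comp fst).
    by apply/(degree_lt_comp (pi := fst) _ _ surj1); rewrite -(fstE u hu).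
  move=> [g /(polyharmonic_spaceP b1 symS1 n _ hd)[Lg hg] <-].
  apply/(polyharmonic_spaceP b hS n _ hd); split=> [x|].
    by rewrite (iter_laplacian_comp fst) /= Lg.
  exact/(degree_lt_comp (pi := fst) _ _ surj1).
- move=> f /(polyharmonic_spaceP b hS n _ hd)[Lf hf]; split; first exact: inv.
  exists (fun z => f (phi' z, 0)); split; last first.
    by move=> x; rewrite {1}(phiE f hf).
  have : degree_lt k.+1 (fun z => f (phi' z, 0)).
    by apply/(degree_lt_comp (pi := phi \o fst) _ _ surj); rewrite -(phiE f hf).
  by move=> /newton_expansion ->; exact: is_polynomial_newton_sum.
rewrite fk sum_multichoose //.
(* Both sets are cut out by [L^n u = 0] and degree [<= [d]]; such a [u] factors through [Z^m] by
   [phiE]. *)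
rewrite (_ : polyharmonic_space n d S b =
    polyharmonic_polynomials S (phi \o fst) n k.+1).
  exact: (has_dim_polyharmonic R (pi := phi \o fst) surj n k (Ordinal hm) hS).
apply/seteqP; split=> u.
  move=> /(polyharmonic_spaceP b hS n _ hd)[Lu hu].
  by exists (fun z => u (phi' z, 0)); split=> //; exact: phiE.
by move=> [f [_ Lu hu]]; apply/(polyharmonic_spaceP b hS n _ hd).
Qed.
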